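(* Let $(H,h)$ be an equivariant pair with $h(\infty)=\infty$, regarded as a homeomorphism $h:\mathbb{C}\to\mathbb{C}$. For $X\subset\mathbb{C}$ let $\alpha(X)$ be the supremum of $\sum_i\mathrm{area}(D_i)$ over all finite collections $\{D_i\}$ of pairwise disjoint disks contained in $X$, and for each closed interval $J\subset[0,1]$ let $A(J)=\alpha(h([0,1]\times J))$. Suppose $y\in(0,1)$ is a stiff point for $A$, i.e. there is some $N$ such that no closed interval $J\subset[0,1]$ centered at $y$ satisfies $A(J)\ge N|J|$. Then for every real linear projection $\pi:\mathbb{C}\to\mathbb{R}$, the function $t\mapsto\pi(h(t,y))$, $t\in[0,1]$, is absolutely continuous.
   Context: $\mathbb{H}^3$ is the upper half space model $\mathbb{C}\times(0,\infty)$ of hyperbolic $3$-space with ideal boundary $S=\mathbb{C}\cup\{\infty\}$; $\mathcal{I}$ is its isometry group, acting also on $S$ by conformal transformations. A nice lattice is a subgroup $\Gamma\subset\mathcal{I}$ acting freely, properly discontinuously and cocompactly on $\mathbb{H}^3$. An equivariant pair $(H,h)$ consists of a bi-Lipschitz bijection $H:\mathbb{H}^3\to\mathbb{H}^3$ and a homeomorphism $h:S\to S$ such that $H\cup h$ is continuous on $\mathbb{H}^3\cup S$, with nice lattices $\Gamma_1,\Gamma_2$ satisfying $H\Gamma_1H^{-1}=\Gamma_2$, $h\Gamma_1h^{-1}=\Gamma_2$. Points of $\mathbb{C}$ are written $(x,y)=x+iy$; $|J|$ is the length of $J$. *)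

(* Defs.v *)
From Stdlib Require Import Reals Lra List.
From Coquelicot Require Import Rbar Lub.
Open Scope R_scope.

(* A point of C is a pair (x,y) = x + i y. *)
Definition pt2 := (R * R)%type.
Definition dist2 (z w : pt2) : R :=
  sqrt ((fst z - fst w)^2 + (snd z - snd w)^2).

(* Upper half space H^3 = C x (0,oo): ((x,y),t) with t > 0. *)
Definition H3 := { p : (R * R * R)%type | 0 < snd p }.
Definition H3x (p : H3) : R := fst (fst (proj1_sig p)).
Definition H3y (p : H3) : R := snd (fst (proj1_sig p)).
Definition H3t (p : H3) : R := snd (proj1_sig p).

(* Ideal boundary S = C u {oo}; None is oo. *)
Definition Sbd := option pt2.

(* hyperbolic distance: cosh d = 1 + |p-q|^2/(2 t_p t_q) *)
Definition arcosh (x : R) : R := ln (x + sqrt (x^2 - 1)).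
Definition hdist (p q : H3) : R :=
  arcosh (1 + ((H3x p - H3x q)^2 + (H3y p - H3y q)^2 + (H3t p - H3t q)^2)
              / (2 * H3t p * H3t q)).

(* Closure of H^3 in the one-point compactification R^3 u {oo} = S^3,
   embedded via inverse stereographic projection; we use the induced
   (chordal) metric. *)
Definition Hbar := (H3 + Sbd)%type.
Definition stereo (x y t : R) : R * R * R * R :=
  let n := x^2 + y^2 + t^2 in
  (2*x/(n+1), 2*y/(n+1), 2*t/(n+1), (n-1)/(n+1)).
Definition embS (z : Sbd) : R * R * R * R :=
  match z with Some (x, y) => stereo x y 0 | None => (0, 0, 0, 1) end.
Definition embHbar (p : Hbar) : R * R * R * R :=
  match p with
  | inl q => stereo (H3x q) (H3y q) (H3t q)
  | inr z => embS z
  end.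
Definition dist4 (u v : R * R * R * R) : R :=
  match u, v with (a1, a2, a3, a4), (b1, b2, b3, b4) =>
    sqrt ((a1-b1)^2 + (a2-b2)^2 + (a3-b3)^2 + (a4-b4)^2) end.
Definition chordS (z w : Sbd) : R := dist4 (embS z) (embS w).
Definition chordHbar (p q : Hbar) : R := dist4 (embHbar p) (embHbar q).

Definition continuous_S (f : Sbd -> Sbd) : Prop :=
  forall z eps, 0 < eps -> exists del, 0 < del /\
    forall w, chordS z w < del -> chordS (f z) (f w) < eps.
Definition continuous_Hbar (F : Hbar -> Hbar) : Prop :=
  forall p eps, 0 < eps -> exists del, 0 < del /\
    forall q, chordHbar p q < del -> chordHbar (F p) (F q) < eps.

Definition union_map (F : H3 -> H3) (f : Sbd -> Sbd) (p : Hbar) : Hbar :=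
  match p with inl q => inl (F q) | inr z => inr (f z) end.

Definition bijective {A B : Type} (f : A -> B) : Prop :=
  (forall a1 a2, f a1 = f a2 -> a1 = a2) /\ (forall b, exists a, f a = b).

Definition homeomorphism_S (f : Sbd -> Sbd) : Prop :=
  bijective f /\ continuous_S f /\
  exists g : Sbd -> Sbd, (forall z, g (f z) = z) /\ (forall z, f (g z) = z)
                     /\ continuous_S g.

Definition isometry (g : H3 -> H3) : Prop :=
  (forall p q, hdist (g p) (g q) = hdist p q) /\ (forall q, exists p, g p = q).

(* gb : Sbd -> Sbd is the boundary action of g: g u gb is continuous on H^3 u Sbd
   (this extension exists and is unique for every isometry). *)
Definition boundary_ext (g : H3 -> H3) (gb : Sbd -> Sbd) : Prop :=
  continuous_Hbar (union_map g gb).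

Definition compact_H3 (K : H3 -> Prop) : Prop :=
  forall u : nat -> H3, (forall n, K (u n)) ->
    exists (phi : nat -> nat) (p : H3), (forall n, (phi n < phi (Datatypes.S n))%nat) /\ K p /\
      forall eps, 0 < eps -> exists N, forall n, (N <= n)%nat ->
        hdist (u (phi n)) p < eps.

Definition subgroup_I (G : (H3 -> H3) -> Prop) : Prop :=
  (forall g, G g -> isometry g) /\
  G (fun p => p) /\
  (forall g1 g2, G g1 -> G g2 -> G (fun p => g1 (g2 p))) /\
  (forall g, G g -> exists g', G g' /\ (forall p, g' (g p) = p) /\ (forall p, g (g' p) = p)).

Definition nice_lattice (G : (H3 -> H3) -> Prop) : Prop :=
  subgroup_I G /\
  (forall g, G g -> forall p, g p = p -> forall q, g q = q) /\
  (forall K, compact_H3 K -> exists l : list (H3 -> H3),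
      forall g, G g -> (exists p, K p /\ K (g p)) -> In g l) /\
  (exists K, compact_H3 K /\ forall p, exists g q, G g /\ K q /\ g q = p).

Definition bilipschitz_bij (F : H3 -> H3) : Prop :=
  bijective F /\ exists L, 0 < L /\
    forall p q, hdist p q / L <= hdist (F p) (F q) <= L * hdist p q.

Definition equivariant_pair (F : H3 -> H3) (f : Sbd -> Sbd) : Prop :=
  bilipschitz_bij F /\ homeomorphism_S f /\ continuous_Hbar (union_map F f) /\
  exists G1 G2, nice_lattice G1 /\ nice_lattice G2 /\
    (forall g, G2 g <-> exists g1, G1 g1 /\ forall p, g (F p) = F (g1 p)) /\
    (forall gb, (exists g, G2 g /\ boundary_ext g gb) <->
       exists g1 gb1, G1 g1 /\ boundary_ext g1 gb1 /\
                      forall z, gb (f z) = f (gb1 z)).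

(* h restricted to C (when h(oo) = oo) *)
Definition hC (f : Sbd -> Sbd) (z : pt2) : pt2 :=
  match f (Some z) with Some w => w | None => (0, 0) end.

Definition disk_in (X : pt2 -> Prop) (d : pt2 * R) : Prop :=
  0 < snd d /\ forall w, dist2 w (fst d) < snd d -> X w.
Definition disks_disjoint (l : list (pt2 * R)) : Prop :=
  forall i j, (i < j < length l)%nat ->
    forall w, ~ (dist2 w (fst (nth i l ((0,0),0))) < snd (nth i l ((0,0),0)) /\
                 dist2 w (fst (nth j l ((0,0),0))) < snd (nth j l ((0,0),0))).
Definition total_area (l : list (pt2 * R)) : R :=
  fold_right (fun d s => PI * (snd d)^2 + s) 0 l.

Definition alpha (X : pt2 -> Prop) : Rbar :=
  Lub_Rbar (fun s => exists l, (forall d, In d l -> disk_in X d) /\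
                               disks_disjoint l /\ s = total_area l).

Definition A_fun (f : Sbd -> Sbd) (c d : R) : Rbar :=
  alpha (fun z => exists s t, 0 <= s <= 1 /\ c <= t <= d /\ z = hC f (s, t)).

Definition stiff (f : Sbd -> Sbd) (y : R) : Prop :=
  exists N : R, forall r, 0 < r -> 0 <= y - r -> y + r <= 1 ->
    ~ Rbar_le (Finite (N * (2 * r))) (A_fun f (y - r) (y + r)).

Definition nonoverlapping (l : list (R * R)) : Prop :=
  forall i j, (i < j < length l)%nat ->
    snd (nth i l (0,0)) <= fst (nth j l (0,0)) \/
    snd (nth j l (0,0)) <= fst (nth i l (0,0)).
Definition abs_cont_01 (u : R -> R) : Prop :=
  forall eps, 0 < eps -> exists del, 0 < del /\
    forall l : list (R * R),
      (forall ab, In ab l -> 0 <= fst ab <= snd ab /\ snd ab <= 1) ->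
      nonoverlapping l ->
      fold_right (fun ab s => (snd ab - fst ab) + s) 0 l < del ->
      fold_right (fun ab s => Rabs (u (snd ab) - u (fst ab)) + s) 0 l < eps.

(* Main.v *)
Require Import Defs.
From Stdlib Require Import Reals Lra Lia List ClassicalEpsilon.
From Coquelicot Require Import Coquelicot.
Open Scope R_scope.

(** The boundary map is weakly quasisymmetric: [|z - c| <= |w - c|] implies
    [|h z - h c| <= K |h w - h c|]. Indeed, writing [C = cosh d], the chordal metric satisfies
    [chord(p, q)^2 = 2 (C(p, q) - 1) / (C(o, p) C(o, q))] for interior points [p], [q] and
    [o = (0, 0, 1)], so the chordal cross ratio of four interior points is invariant under
    isometries. For points near [z], [c], [w], [oo], an element of the first lattice moves
    [(c, |z - c|)] into a fixed compact set, and then separates [c] from [w] and [z] from [oo] by a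
    definite chordal amount. Since [H] with [h] is injective on the compact closed ball, and
    conjugation by [H] turns this lattice element into an isometry, the cross ratio of the images
    is bounded; passing to the boundary gives the claim.

    Cut a family of [m] intervals of total length [< del] into [n <= del / 2r + m] pieces of
    length at most [2r]. The disk having a piece as diameter contains, after applying [h], a disk
    whose radius is comparable to the displacement of [h] over the piece. These image disks are
    disjoint and lie in [h ([0,1] x [y - r, y + r])], so stiffness bounds their total area by
    [2 r N], and Cauchy-Schwarz bounds the total displacement by [O(sqrt (N del))] once [r] is small. *)

(** * Hyperbolic distance through its hyperbolic cosine *)

Lemma sum4_sqr_ge0 a b c d : 0 <= a^2 + b^2 + c^2 + d^2.
Proof. nra. Qed.

Lemma sum3_sqr_ge0 a b c : 0 <= a^2 + b^2 + c^2.
Proof. nra. Qed.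

Definition sqdist3 (x y t x' y' t' : R) : R := (x - x')^2 + (y - y')^2 + (t - t')^2.

(** This is the argument of [arcosh] in [hdist]. Unlike the distance itself it is rational in the
    coordinates, so identities about it reduce to algebra. *)
Definition hcosh (p q : H3) : R :=
  1 + sqdist3 (H3x p) (H3y p) (H3t p) (H3x q) (H3y q) (H3t q) / (2 * H3t p * H3t q).

Definition mkH3 (x y t : R) (ht : 0 < t) : H3 :=
  exist (fun p : R * R * R => 0 < snd p) (x, y, t) ht.

Definition H3o : H3 := mkH3 0 0 1 Rlt_0_1.

Lemma H3t_pos p : 0 < H3t p.
Proof. exact (proj2_sig p). Qed.

Lemma hcosh_ge1 p q : 1 <= hcosh p q.
Proof.
  unfold hcosh, sqdist3. pose proof (H3t_pos p); pose proof (H3t_pos q).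
  enough (0 <= ((H3x p - H3x q)^2 + (H3y p - H3y q)^2 + (H3t p - H3t q)^2)
                 / (2 * H3t p * H3t q)) by lra.
  apply Rdiv_le_0_compat; [apply sum3_sqr_ge0 | repeat apply Rmult_lt_0_compat; lra].
Qed.

Lemma arcosh_inj x y : 1 <= x -> 1 <= y -> arcosh x = arcosh y -> x = y.
Proof.
  assert (lt_case : forall x y, 1 <= x -> x < y -> arcosh x < arcosh y).
  { intros u v hu huv. unfold arcosh. apply ln_increasing.
    - pose proof (sqrt_pos (u^2 - 1)); lra.
    - enough (sqrt (u^2 - 1) <= sqrt (v^2 - 1)) by lra.
      apply sqrt_le_1_alt; nra. }
  intros hx hy e. destruct (Rtotal_order x y) as [h | [h | h]]; auto.
  - specialize (lt_case x y hx h); lra.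
  - specialize (lt_case y x hy h); lra.
Qed.

Lemma hcosh_isometry g p q : isometry g -> hcosh (g p) (g q) = hcosh p q.
Proof. intros [h _]. apply arcosh_inj; try apply hcosh_ge1. apply h. Qed.

(** Since [arcosh x = ln (x + sqrt (x^2 - 1))], it is at least [ln x]. *)
Lemma hcosh_lt_exp p q r : hdist p q < r -> hcosh p q < exp r.
Proof.
  change (hdist p q) with (arcosh (hcosh p q)). intros h.
  pose proof (hcosh_ge1 p q). pose proof (sqrt_pos (hcosh p q ^ 2 - 1)).
  apply exp_increasing in h. unfold arcosh in h. rewrite exp_ln in h; lra.
Qed.

Lemma hcosh_sym p q : hcosh p q = hcosh q p.
Proof.
  unfold hcosh, sqdist3. pose proof (H3t_pos p); pose proof (H3t_pos q). field; lra.
Qed.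

Lemma hcosh_o p : hcosh H3o p = (H3x p ^ 2 + H3y p ^ 2 + H3t p ^ 2 + 1) / (2 * H3t p).
Proof.
  unfold hcosh, sqdist3. pose proof (H3t_pos p).
  change (H3x H3o) with 0; change (H3y H3o) with 0; change (H3t H3o) with 1. field; lra.
Qed.

(* [cosh (a + b) <= 2 cosh a cosh b] together with the triangle inequality. *)
Lemma hcosh_o_triangle x p : hcosh H3o p <= 2 * hcosh H3o x * hcosh x p.
Proof.
  rewrite !hcosh_o. unfold hcosh, sqdist3.
  pose proof (H3t_pos p) as hp; pose proof (H3t_pos x) as hx.
  set (a := H3x x) in *; set (b := H3y x) in *; set (s := H3t x) in *.
  set (u := H3x p) in *; set (v := H3y p) in *; set (t := H3t p) in *.
  clearbody a b s u v t.
  replace (2 * ((a^2 + b^2 + s^2 + 1) / (2 * s)) *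
     (1 + ((a - u)^2 + (b - v)^2 + (s - t)^2) / (2 * s * t)))
    with ((a^2 + b^2 + s^2 + 1) * ((a - u)^2 + (b - v)^2 + s^2 + t^2) / (s^2) / (2 * t))
    by (field; lra).
  apply Rmult_le_compat_r; [left; apply Rinv_0_lt_compat; lra |].
  apply Rmult_le_reg_r with (s^2); [nra |].
  replace ((a^2 + b^2 + s^2 + 1) * ((a - u)^2 + (b - v)^2 + s^2 + t^2) / s^2 * s^2)
    with ((a^2 + b^2 + s^2 + 1) * ((a - u)^2 + (b - v)^2 + s^2 + t^2)) by (field; lra).
  set (d := u - a). set (e := v - b).
  replace u with (a + d) by (unfold d; ring). replace v with (b + e) by (unfold e; ring).
  clearbody d e.
  pose proof (pow2_ge_0 (a * d + b * e - s^2)) as h1.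
  pose proof (pow2_ge_0 (a * e - b * d)) as h2.
  pose proof (pow2_ge_0 (a * t)). pose proof (pow2_ge_0 (b * t)).
  pose proof (pow2_ge_0 d). pose proof (pow2_ge_0 e). pose proof (pow2_ge_0 t).
  nra.
Qed.

(** * The chordal metric on the closed ball *)

Definition chord2 (a b : Hbar) : R := chordHbar a b ^ 2.

Lemma dist4_sqr a1 a2 a3 a4 b1 b2 b3 b4 :
  dist4 (a1, a2, a3, a4) (b1, b2, b3, b4) ^ 2 =
  (a1 - b1)^2 + (a2 - b2)^2 + (a3 - b3)^2 + (a4 - b4)^2.
Proof. unfold dist4. apply pow2_sqrt, sum4_sqr_ge0. Qed.

Lemma stereo_chord x y t x' y' t' :
  dist4 (stereo x y t) (stereo x' y' t') ^ 2 =
  4 * sqdist3 x y t x' y' t' / ((x^2 + y^2 + t^2 + 1) * (x'^2 + y'^2 + t'^2 + 1)).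
Proof.
  unfold stereo. rewrite dist4_sqr. unfold sqdist3. field. split; nra.
Qed.

Lemma stereo_chord_infty x y t :
  dist4 (stereo x y t) (0, 0, 0, 1) ^ 2 = 4 / (x^2 + y^2 + t^2 + 1).
Proof. unfold stereo. rewrite dist4_sqr. field. nra. Qed.

(** The squared Euclidean distance is [2 t_p t_q (cosh d(p, q) - 1)], and the stereographic factor
    [|p|^2 + 1] equals [2 t_p cosh d(o, p)]; the heights cancel. *)
Lemma chord2_hcosh p q :
  chord2 (inl p) (inl q) = 2 * (hcosh p q - 1) / (hcosh H3o p * hcosh H3o q).
Proof.
  unfold chord2, chordHbar, embHbar. rewrite stereo_chord, !hcosh_o. unfold hcosh.
  pose proof (H3t_pos p); pose proof (H3t_pos q). field. repeat split; nra.
Qed.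

Lemma chordHbar_ge0 a b : 0 <= chordHbar a b.
Proof.
  unfold chordHbar, dist4. destruct (embHbar a) as [[[? ?] ?] ?].
  destruct (embHbar b) as [[[? ?] ?] ?]. apply sqrt_pos.
Qed.

Lemma dist4_sym u v : dist4 u v = dist4 v u.
Proof.
  destruct u as [[[a1 a2] a3] a4], v as [[[b1 b2] b3] b4].
  unfold dist4. f_equal. ring.
Qed.

Lemma dist4_triangle u v w : dist4 u w <= dist4 u v + dist4 v w.
Proof.
  destruct u as [[[a1 a2] a3] a4], v as [[[b1 b2] b3] b4], w as [[[c1 c2] c3] c4].
  unfold dist4.
  set (p1 := a1 - b1); set (p2 := a2 - b2); set (p3 := a3 - b3); set (p4 := a4 - b4).
  set (q1 := b1 - c1); set (q2 := b2 - c2); set (q3 := b3 - c3); set (q4 := b4 - c4).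
  replace (a1 - c1) with (p1 + q1) by (unfold p1, q1; ring).
  replace (a2 - c2) with (p2 + q2) by (unfold p2, q2; ring).
  replace (a3 - c3) with (p3 + q3) by (unfold p3, q3; ring).
  replace (a4 - c4) with (p4 + q4) by (unfold p4, q4; ring).
  clearbody p1 p2 p3 p4 q1 q2 q3 q4.
  set (P := p1^2 + p2^2 + p3^2 + p4^2). set (Q := q1^2 + q2^2 + q3^2 + q4^2).
  assert (hP : 0 <= P) by (unfold P; nra). assert (hQ : 0 <= Q) by (unfold Q; nra).
  pose proof (sqrt_pos P); pose proof (sqrt_pos Q).
  apply Rsqr_incr_0_var; [| lra]. rewrite Rsqr_sqrt by apply sum4_sqr_ge0.
  unfold Rsqr.
  replace ((sqrt P + sqrt Q) * (sqrt P + sqrt Q)) with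
    (sqrt P * sqrt P + sqrt Q * sqrt Q + 2 * (sqrt P * sqrt Q)) by ring.
  rewrite !sqrt_sqrt by assumption. rewrite <- sqrt_mult by assumption.
  enough (hcs : p1 * q1 + p2 * q2 + p3 * q3 + p4 * q4 <= sqrt (P * Q))
    by (unfold P at 1, Q at 1; lra).
  apply Rle_trans with (Rabs (p1 * q1 + p2 * q2 + p3 * q3 + p4 * q4)); [apply Rle_abs |].
  rewrite <- sqrt_Rsqr_abs. apply sqrt_le_1_alt.
  (* Lagrange's identity, which gives Cauchy-Schwarz in dimension four. *)
  replace (P * Q) with ((p1 * q1 + p2 * q2 + p3 * q3 + p4 * q4)^2
    + (p1 * q2 - p2 * q1)^2 + (p1 * q3 - p3 * q1)^2 + (p1 * q4 - p4 * q1)^2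
    + (p2 * q3 - p3 * q2)^2 + (p2 * q4 - p4 * q2)^2 + (p3 * q4 - p4 * q3)^2)
    by (unfold P, Q; ring).
  unfold Rsqr.
  pose proof (pow2_ge_0 (p1 * q2 - p2 * q1)). pose proof (pow2_ge_0 (p1 * q3 - p3 * q1)).
  pose proof (pow2_ge_0 (p1 * q4 - p4 * q1)). pose proof (pow2_ge_0 (p2 * q3 - p3 * q2)).
  pose proof (pow2_ge_0 (p2 * q4 - p4 * q2)). pose proof (pow2_ge_0 (p3 * q4 - p4 * q3)).
  lra.
Qed.

Lemma chordHbar_sym a b : chordHbar a b = chordHbar b a.
Proof. apply dist4_sym. Qed.

Lemma chordHbar_triangle a b c : chordHbar a c <= chordHbar a b + chordHbar b c.
Proof. apply dist4_triangle. Qed.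

Lemma embHbar_sphere a : exists u1 u2 u3 u4,
  embHbar a = (u1, u2, u3, u4) /\ u1^2 + u2^2 + u3^2 + u4^2 = 1 /\ 0 <= u3.
Proof.
  destruct a as [q | [[x y] |]]; cbn [embHbar embS].
  - unfold stereo. do 4 eexists. split; [reflexivity |]. pose proof (H3t_pos q). split.
    + field. nra.
    + apply Rdiv_le_0_compat; nra.
  - unfold stereo. do 4 eexists. split; [reflexivity |]. split.
    + field. nra.
    + apply Rdiv_le_0_compat; nra.
  - do 4 eexists. split; [reflexivity |]. lra.
Qed.

(** Stereographic projection from [(0, 0, 0, 1)] inverts the embedding: that pole comes from
    infinity, the rest of [u3 = 0] from finite boundary points, and [u3 > 0] from the interior. So
    [Hbar] is a closed hemisphere, which is what makes it compact. *)
Lemma embHbar_onto u1 u2 u3 u4 :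
  u1^2 + u2^2 + u3^2 + u4^2 = 1 -> 0 <= u3 -> exists a, embHbar a = (u1, u2, u3, u4).
Proof.
  intros hn h3.
  destruct (Req_dec u4 1) as [-> | h4].
  { exists (inr None). cbn. repeat f_equal; nra. }
  assert (h4' : 1 - u4 > 0) by nra.
  assert (he : stereo (u1 / (1 - u4)) (u2 / (1 - u4)) (u3 / (1 - u4)) = (u1, u2, u3, u4)).
  { unfold stereo.
    replace ((u1 / (1 - u4))^2 + (u2 / (1 - u4))^2 + (u3 / (1 - u4))^2)
      with ((1 + u4) / (1 - u4)).
    - repeat f_equal; field; split; lra.
    - apply Rmult_eq_reg_r with ((1 - u4)^2); [| nra].
      field_simplify; [| lra | lra]. nra. }
  destruct (Rlt_or_le 0 u3) as [hp | hz].
  - assert (hq : 0 < u3 / (1 - u4)) by (apply Rdiv_lt_0_compat; lra).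
    exists (inl (mkH3 (u1 / (1 - u4)) (u2 / (1 - u4)) _ hq)). exact he.
  - exists (inr (Some (u1 / (1 - u4), u2 / (1 - u4)))). cbn [embHbar embS].
    rewrite <- he. f_equal. replace u3 with 0 by lra. field; lra.
Qed.

Lemma stereo_inj x y t x' y' t' :
  dist4 (stereo x y t) (stereo x' y' t') = 0 -> x = x' /\ y = y' /\ t = t'.
Proof.
  intros h. pose proof (stereo_chord x y t x' y' t') as e. rewrite h in e.
  pose proof (sum3_sqr_ge0 x y t). pose proof (sum3_sqr_ge0 x' y' t').
  assert (hz : sqdist3 x y t x' y' t' = 0).
  { unfold Rdiv in e. symmetry in e. rewrite pow_ne_zero in e by lia.
    apply Rmult_integral in e. destruct e as [e | e]; [lra |].
    exfalso. revert e. apply Rinv_neq_0_compat. nra. }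
  unfold sqdist3 in hz. pose proof (pow2_ge_0 (x - x')). pose proof (pow2_ge_0 (y - y')).
  pose proof (pow2_ge_0 (t - t')). repeat split; nra.
Qed.

Lemma chordHbar_eq0 a b : chordHbar a b = 0 -> a = b.
Proof.
  assert (inf : forall x y t, dist4 (stereo x y t) (0, 0, 0, 1) <> 0).
  { intros x y t h. pose proof (stereo_chord_infty x y t) as e. rewrite h in e.
    assert (0 < 4 / (x^2 + y^2 + t^2 + 1)) by (apply Rdiv_lt_0_compat; nra). nra. }
  unfold chordHbar. intros h.
  destruct a as [[[[x y] t] ht] | [[x y] |]], b as [[[[x' y'] t'] ht'] | [[x' y'] |]];
    cbn in ht, ht' || cbn in ht || cbn in ht' || idtac;
    unfold embHbar, embS, H3x, H3y, H3t in h; cbn [proj1_sig fst snd] in h;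
    try (now destruct (inf _ _ _ h)); try (rewrite dist4_sym in h; now destruct (inf _ _ _ h));
    try (apply stereo_inj in h; destruct h as (-> & -> & e)); try (exfalso; lra).
  - subst t'. do 2 f_equal. apply proof_irrelevance.
  - reflexivity.
  - reflexivity.
Qed.

Lemma chordHbar_le2 a b : chordHbar a b <= 2.
Proof.
  destruct (embHbar_sphere a) as (a1 & a2 & a3 & a4 & ea & na & _).
  destruct (embHbar_sphere b) as (b1 & b2 & b3 & b4 & eb & nb & _).
  pose proof (chordHbar_ge0 a b).
  assert (chordHbar a b ^ 2 <= 2^2).
  { unfold chordHbar. rewrite ea, eb, dist4_sqr.
    pose proof (pow2_ge_0 (a1 + b1)). pose proof (pow2_ge_0 (a2 + b2)).
    pose proof (pow2_ge_0 (a3 + b3)). pose proof (pow2_ge_0 (a4 + b4)). nra. }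
  nra.
Qed.

(** * Sequential compactness of the closed ball *)

Lemma filterlim_ge_id (phi : nat -> nat) :
  (forall n, (n <= phi n)%nat) -> filterlim phi eventually eventually.
Proof.
  intros h P [N hN]. exists N. intros n hn. apply hN. specialize (h n). lia.
Qed.

(** Bolzano-Weierstrass yields a cluster value [l]; choosing for each [n] an index [p >= n] with
    [u p] within [1 / (n + 1)] of [l] turns it into a limit. The condition [n <= phi n] suffices for
    limits and is stable under composition. *)
Lemma bounded_subseq (u : nat -> R) (M : R) :
  (forall n, Rabs (u n) <= M) ->
  exists (phi : nat -> nat) (l : R),
    (forall n, (n <= phi n)%nat) /\ is_lim_seq (fun n => u (phi n)) l.
Proof.
  intros hM.
  destruct (Bolzano_Weierstrass u (fun c => - M <= c <= M)) as [l hl].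
  { apply compact_P3. }
  { intros n. apply Rabs_le_between, hM. }
  assert (hpos : forall n, 0 < / (INR n + 1)) by apply RinvN_pos.
  assert (hp : forall n, exists p, (n <= p)%nat /\ Rabs (u p - l) < / (INR n + 1)).
  { intros n. apply (hl (disc l (mkposreal _ (hpos n))) n).
    exists (mkposreal _ (hpos n)). intros x hx. exact hx. }
  exists (fun n => proj1_sig (constructive_indefinite_description _ (hp n))), l.
  split; [intros n; apply (proj2_sig (constructive_indefinite_description _ (hp n))) |].
  apply is_lim_seq_spec. intros eps.
  destruct (@RinvN_cv eps (cond_pos eps)) as [N hN]. exists N. intros n hn.
  destruct (constructive_indefinite_description _ (hp n)) as [p [hnp hpl]]; simpl.
  specialize (hN n hn). unfold Rdist in hN. rewrite Rminus_0_r in hN. simpl in hN.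
  rewrite Rabs_pos_eq in hN by (left; apply hpos). lra.
Qed.

Definition cvHbar (u : nat -> Hbar) (a : Hbar) : Prop :=
  forall eps, 0 < eps -> exists N, forall n, (N <= n)%nat -> chordHbar a (u n) < eps.

Lemma cvHbar_subseq u a (phi : nat -> nat) :
  (forall n, (n <= phi n)%nat) -> cvHbar u a -> cvHbar (fun n => u (phi n)) a.
Proof.
  intros hphi hu eps heps. destruct (hu eps heps) as [N hN]. exists N.
  intros n hn. apply hN. specialize (hphi n). lia.
Qed.

Lemma cvHbar_continuous G u a :
  continuous_Hbar G -> cvHbar u a -> cvHbar (fun n => G (u n)) (G a).
Proof.
  intros hG hu eps heps. destruct (hG a eps heps) as [d [hd hGd]].
  destruct (hu d hd) as [N hN]. exists N. intros n hn. apply hGd, hN, hn.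
Qed.

Lemma is_lim_seq_chord u v a b :
  cvHbar u a -> cvHbar v b ->
  is_lim_seq (fun n => chordHbar (u n) (v n)) (chordHbar a b).
Proof.
  intros hu hv. apply is_lim_seq_spec. intros eps.
  assert (h2 : 0 < eps / 2) by (pose proof (cond_pos eps); lra).
  destruct (hu _ h2) as [N1 h1]. destruct (hv _ h2) as [N2 h3].
  exists (max N1 N2). intros n hn. specialize (h1 n ltac:(lia)). specialize (h3 n ltac:(lia)).
  pose proof (chordHbar_triangle a (u n) b). pose proof (chordHbar_triangle (u n) (v n) b).
  pose proof (chordHbar_triangle (u n) a (v n)). pose proof (chordHbar_triangle a b (v n)).
  rewrite (chordHbar_sym (v n) b) in *. rewrite (chordHbar_sym (u n) a) in *.
  apply Rabs_lt_between. lra.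
Qed.

(** Subsequences are extracted for the four coordinates in turn. The limit vector still lies on the
    closed hemisphere, hence is the image of a point. *)
Lemma Hbar_seq_compact (u : nat -> Hbar) :
  exists (phi : nat -> nat) (a : Hbar),
    (forall n, (n <= phi n)%nat) /\ cvHbar (fun n => u (phi n)) a.
Proof.
  set (e1 n := fst (fst (fst (embHbar (u n))))). set (e2 n := snd (fst (fst (embHbar (u n))))).
  set (e3 n := snd (fst (embHbar (u n)))). set (e4 n := snd (embHbar (u n))).
  assert (he : forall n, embHbar (u n) = (e1 n, e2 n, e3 n, e4 n)).
  { intros n. unfold e1, e2, e3, e4. now destruct (embHbar (u n)) as [[[? ?] ?] ?]. }
  assert (hs : forall n, e1 n ^ 2 + e2 n ^ 2 + e3 n ^ 2 + e4 n ^ 2 = 1 /\ 0 <= e3 n).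
  { intros n. destruct (embHbar_sphere (u n)) as (a & b & c & d & h & h').
    rewrite he in h. injection h as -> -> -> ->. exact h'. }
  clearbody e1 e2 e3 e4.
  assert (habs : forall x, x^2 <= 1 -> Rabs x <= 1).
  { intros x hx. apply Rabs_le_between. nra. }
  destruct (bounded_subseq e1 1) as (f1 & l1 & hf1 & hl1).
  { intros n. apply habs. specialize (hs n). nra. }
  destruct (bounded_subseq (fun n => e2 (f1 n)) 1) as (f2 & l2 & hf2 & hl2).
  { intros n. apply habs. specialize (hs (f1 n)). nra. }
  destruct (bounded_subseq (fun n => e3 (f1 (f2 n))) 1) as (f3 & l3 & hf3 & hl3).
  { intros n. apply habs. specialize (hs (f1 (f2 n))). nra. }
  destruct (bounded_subseq (fun n => e4 (f1 (f2 (f3 n)))) 1) as (f4 & l4 & hf4 & hl4).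
  { intros n. apply habs. specialize (hs (f1 (f2 (f3 n)))). nra. }
  set (phi n := f1 (f2 (f3 (f4 n)))).
  assert (hphi : forall n, (n <= phi n)%nat).
  { intros n. unfold phi. specialize (hf4 n). specialize (hf3 (f4 n)).
    specialize (hf2 (f3 (f4 n))). specialize (hf1 (f2 (f3 (f4 n)))). lia. }
  assert (c3 : is_lim_seq (fun n => e3 (phi n)) l3).
  { apply (is_lim_seq_subseq _ _ f4 (filterlim_ge_id _ hf4) hl3). }
  assert (c2 : is_lim_seq (fun n => e2 (phi n)) l2).
  { apply (is_lim_seq_subseq (fun n => e2 (f1 (f2 n))) _ (fun n => f3 (f4 n))); auto.
    apply filterlim_ge_id. intros n. specialize (hf4 n). specialize (hf3 (f4 n)). lia. }
  assert (c1 : is_lim_seq (fun n => e1 (phi n)) l1).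
  { apply (is_lim_seq_subseq (fun n => e1 (f1 n)) _ (fun n => f2 (f3 (f4 n)))); auto.
    apply filterlim_ge_id. intros n. specialize (hf4 n). specialize (hf3 (f4 n)).
    specialize (hf2 (f3 (f4 n))). lia. }
  assert (sq : forall (v : nat -> R) (l : R), is_lim_seq v l -> is_lim_seq (fun n => v n ^ 2) (l ^ 2)).
  { intros v l h. simpl. apply is_lim_seq_mult'; [exact h |].
    apply is_lim_seq_mult'; [exact h | apply is_lim_seq_const]. }
  assert (hsum : l1^2 + l2^2 + l3^2 + l4^2 = 1).
  { assert (hl : is_lim_seq (fun n => e1 (phi n) ^ 2 + e2 (phi n) ^ 2 + e3 (phi n) ^ 2
        + e4 (phi n) ^ 2) (l1^2 + l2^2 + l3^2 + l4^2)).
    { repeat apply is_lim_seq_plus'; apply sq; assumption. }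
    apply is_lim_seq_ext with (v := fun _ => 1) in hl; [| intros n; apply hs].
    apply is_lim_seq_unique in hl. rewrite Lim_seq_const in hl. now injection hl. }
  assert (h3 : 0 <= l3).
  { apply (is_lim_seq_le (fun _ => 0) (fun n => e3 (phi n)) 0 l3); auto.
    - intros n. apply hs.
    - apply is_lim_seq_const. }
  destruct (embHbar_onto l1 l2 l3 l4 hsum h3) as [a ha].
  exists phi, a. split; [exact hphi |].
  assert (hl : is_lim_seq (fun n => chordHbar a (u (phi n))) (sqrt 0)).
  { apply is_lim_seq_ext with (u := fun n => sqrt ((l1 - e1 (phi n))^2 + (l2 - e2 (phi n))^2
      + (l3 - e3 (phi n))^2 + (l4 - e4 (phi n))^2)).
    { intros n. unfold chordHbar. now rewrite ha, he. }
    apply (is_lim_seq_continuous sqrt); [apply continuity_pt_sqrt; lra |].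
    replace 0 with ((l1 - l1)^2 + (l2 - l2)^2 + (l3 - l3)^2 + (l4 - l4)^2) by ring.
    repeat apply is_lim_seq_plus'; apply sq; (apply is_lim_seq_minus';
      [apply is_lim_seq_const | assumption]). }
  rewrite sqrt_0 in hl. apply is_lim_seq_spec in hl. intros eps heps.
  destruct (hl (mkposreal eps heps)) as [N hN]. exists N. intros n hn.
  specialize (hN n hn). simpl in hN. rewrite Rminus_0_r in hN.
  pose proof (Rle_abs (chordHbar a (u (phi n)))). lra.
Qed.

(** Otherwise there are pairs at distance at least [d] whose images are [1 / (n + 1)] close. By
    compactness they accumulate at a pair of distinct points with equal images. *)
Lemma uniformly_injective_Hbar (G : Hbar -> Hbar) :
  continuous_Hbar G -> (forall a b, G a = G b -> a = b) ->
  forall d, 0 < d -> exists e, 0 < e /\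
    forall a b, d <= chordHbar a b -> e <= chordHbar (G a) (G b).
Proof.
  intros hG hinj d hd. apply NNPP. intros hno.
  assert (hpos : forall n, 0 < / (INR n + 1)) by apply RinvN_pos.
  assert (hab : forall n, exists ab : Hbar * Hbar,
    d <= chordHbar (fst ab) (snd ab) /\
    chordHbar (G (fst ab)) (G (snd ab)) < / (INR n + 1)).
  { intros n. apply NNPP. intros hn. apply hno. exists (/ (INR n + 1)). split; [apply hpos |].
    intros a b h. apply Rnot_lt_le. intros h'. apply hn. exists (a, b). split; assumption. }
  set (w n := proj1_sig (constructive_indefinite_description _ (hab n))).
  assert (hw : forall n, d <= chordHbar (fst (w n)) (snd (w n)) /\
    chordHbar (G (fst (w n))) (G (snd (w n))) < / (INR n + 1)).
  { intros n. apply (proj2_sig (constructive_indefinite_description _ (hab n))). }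
  clearbody w.
  destruct (Hbar_seq_compact (fun n => fst (w n))) as (f1 & a & hf1 & ha).
  destruct (Hbar_seq_compact (fun n => snd (w (f1 n)))) as (f2 & b & hf2 & hb).
  apply (cvHbar_subseq _ _ f2 hf2) in ha.
  assert (hphi : forall n, (n <= f1 (f2 n))%nat).
  { intros n. specialize (hf2 n). specialize (hf1 (f2 n)). lia. }
  assert (hd' : d <= chordHbar a b).
  { apply (is_lim_seq_le (fun _ => d) _ d (chordHbar a b)) with
      (2 := is_lim_seq_const d) (3 := is_lim_seq_chord _ _ _ _ ha hb).
    intros n. apply hw. }
  assert (h0 : chordHbar (G a) (G b) <= 0).
  { apply (is_lim_seq_le _ (fun n => / (INR n + 1)) (chordHbar (G a) (G b)) 0) with
      (2 := is_lim_seq_chord _ _ _ _ (cvHbar_continuous _ _ _ hG ha)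
              (cvHbar_continuous _ _ _ hG hb)).
    - intros n. left. eapply Rlt_le_trans; [apply hw |].
      apply Rinv_le_contravar; [pose proof (pos_INR n); lra |].
      specialize (hphi n). apply le_INR in hphi. lra.
    - apply is_lim_seq_Reals, @RinvN_cv. }
  pose proof (chordHbar_ge0 (G a) (G b)).
  assert (e : a = b) by (apply hinj, chordHbar_eq0; lra).
  subst b. pose proof (chordHbar_triangle a a a).
  assert (chordHbar a a = 0); [| lra].
  unfold chordHbar. destruct (embHbar a) as [[[x1 x2] x3] x4]. unfold dist4.
  replace ((x1 - x1)^2 + (x2 - x2)^2 + (x3 - x3)^2 + (x4 - x4)^2) with 0 by ring.
  apply sqrt_0.
Qed.

(** * Compact sets, visual distances and cross ratios *)

(** A sequence in [K] with [cosh d(o, .) > n + 1] would have a subsequence converging to some [p];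
    but within distance 1 of [p] this quantity is at most [2 * cosh d(o, p) * exp 1]. *)
Lemma compact_hcosh_bounded K :
  compact_H3 K -> exists M, 0 < M /\ forall p, K p -> hcosh H3o p <= M.
Proof.
  intros hK. apply NNPP. intros hno.
  assert (hu : forall n, exists p, K p /\ INR n + 1 < hcosh H3o p).
  { intros n. apply NNPP. intros hn. apply hno. exists (INR n + 1).
    split; [pose proof (pos_INR n); lra |]. intros p hp. apply Rnot_lt_le. intros h.
    apply hn. exists p. split; assumption. }
  destruct (hK (fun n => proj1_sig (constructive_indefinite_description _ (hu n))))
    as (phi & p & hphi & _ & hcv).
  { intros n. apply (proj2_sig (constructive_indefinite_description _ (hu n))). }
  destruct (hcv 1 Rlt_0_1) as [N hN].
  set (B := 2 * hcosh H3o p * exp 1).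
  destruct (INR_archimed 1 B Rlt_0_1) as [m hm].
  assert (hge : forall n, (n <= phi n)%nat).
  { induction n as [| n IH]; [lia |]. specialize (hphi n). lia. }
  set (n := max N m). specialize (hN n ltac:(lia)). cbv beta in hN.
  destruct (constructive_indefinite_description _ (hu (phi n))) as [q [hq hlt]].
  cbn [proj1_sig] in hN.
  apply hcosh_lt_exp in hN. rewrite hcosh_sym in hN.
  pose proof (hcosh_o_triangle p q) as htri. pose proof (hcosh_ge1 H3o p).
  assert (hmn : INR m <= INR (phi n)) by (apply le_INR; specialize (hge n); lia).
  assert (2 * hcosh H3o p * hcosh p q <= B) by (apply Rmult_le_compat_l; lra).
  lra.
Qed.

(* The squared chordal distance of [p] and [q] in the ball model centred at [x]. *)
Definition visual (x p q : H3) : R := 2 * (hcosh p q - 1) / (hcosh x p * hcosh x q).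

(** The isometry turns the view from [x] into the view from [g x]. Moving the viewpoint on to [o]
    costs a factor of at most [2 * M] in each denominator, by [hcosh_o_triangle]. *)
Lemma visual_le_chord2 g x p q M :
  isometry g -> 0 < M -> hcosh H3o (g x) <= M ->
  visual x p q <= (2 * M)^2 * chord2 (inl (g p)) (inl (g q)).
Proof.
  intros hg hM hx. rewrite chord2_hcosh. unfold visual.
  assert (bound : forall p, hcosh H3o (g p) <= 2 * M * hcosh x p).
  { intros r. eapply Rle_trans; [apply (hcosh_o_triangle (g x)) |].
    rewrite hcosh_isometry by assumption.
    pose proof (hcosh_ge1 x r). apply Rmult_le_compat_r; lra. }
  rewrite (hcosh_isometry g p q hg).
  pose proof (bound p) as bp. pose proof (bound q) as bq.
  pose proof (hcosh_ge1 x p). pose proof (hcosh_ge1 x q).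
  pose proof (hcosh_ge1 H3o (g p)). pose proof (hcosh_ge1 H3o (g q)).
  pose proof (hcosh_ge1 p q).
  set (A := hcosh x p) in *. set (B := hcosh x q) in *.
  set (A' := hcosh H3o (g p)) in *. set (B' := hcosh H3o (g q)) in *.
  set (E := hcosh p q - 1) in *. assert (hE : 0 <= E) by (unfold E; lra).
  clearbody A B A' B' E.
  apply Rmult_le_reg_r with (A * B * (A' * B')); [repeat apply Rmult_lt_0_compat; lra |].
  replace (2 * E / (A * B) * (A * B * (A' * B'))) with (2 * E * (A' * B')) by (field; lra).
  replace ((2 * M)^2 * (2 * E / (A' * B')) * (A * B * (A' * B')))
    with (2 * E * ((2 * M * A) * (2 * M * B))) by (field; lra).
  apply Rmult_le_compat_l; [lra |]. apply Rmult_le_compat; lra.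
Qed.

(** In [chord2_hcosh] each point contributes its factor [hcosh H3o] once to either product of a
    cross ratio, so these factors cancel and only invariant terms remain. The product form avoids
    dividing by distances that may vanish. *)
Lemma chordal_cross_ratio_isometry g p q r s :
  isometry g ->
  chordHbar (inl p) (inl q) * chordHbar (inl r) (inl s)
    * (chordHbar (inl (g q)) (inl (g r)) * chordHbar (inl (g p)) (inl (g s)))
  = chordHbar (inl (g p)) (inl (g q)) * chordHbar (inl (g r)) (inl (g s))
    * (chordHbar (inl q) (inl r) * chordHbar (inl p) (inl s)).
Proof.
  (* Squaring makes both sides rational in [hcosh]. *)
  intros hg. apply Rsqr_inj.
  1, 2: repeat apply Rmult_le_pos; apply chordHbar_ge0.
  rewrite !Rsqr_mult, !Rsqr_pow2.
  change (chord2 (inl p) (inl q) * chord2 (inl r) (inl s)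
    * (chord2 (inl (g q)) (inl (g r)) * chord2 (inl (g p)) (inl (g s)))
  = chord2 (inl (g p)) (inl (g q)) * chord2 (inl (g r)) (inl (g s))
    * (chord2 (inl q) (inl r) * chord2 (inl p) (inl s))).
  rewrite !chord2_hcosh, !(hcosh_isometry g) by assumption.
  pose proof (hcosh_ge1 H3o p). pose proof (hcosh_ge1 H3o q).
  pose proof (hcosh_ge1 H3o r). pose proof (hcosh_ge1 H3o s).
  pose proof (hcosh_ge1 H3o (g p)). pose proof (hcosh_ge1 H3o (g q)).
  pose proof (hcosh_ge1 H3o (g r)). pose proof (hcosh_ge1 H3o (g s)).
  field. repeat split; lra.
Qed.

Lemma visual_mkH3 x0 y0 t0 h0 x1 y1 t1 h1 x2 y2 t2 h2 :
  visual (mkH3 x0 y0 t0 h0) (mkH3 x1 y1 t1 h1) (mkH3 x2 y2 t2 h2) =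
  4 * t0^2 * sqdist3 x1 y1 t1 x2 y2 t2 /
  (((x0 - x1)^2 + (y0 - y1)^2 + t0^2 + t1^2) * ((x0 - x2)^2 + (y0 - y2)^2 + t0^2 + t2^2)).
Proof.
  unfold visual, hcosh, H3x, H3y, H3t, mkH3; cbn [proj1_sig fst snd].
  set (S := sqdist3 x1 y1 t1 x2 y2 t2). unfold sqdist3.
  pose proof (sum3_sqr_ge0 (x0 - x1) (y0 - y1) (t0 - t1)).
  pose proof (sum3_sqr_ge0 (x0 - x2) (y0 - y2) (t0 - t2)).
  assert (0 < t0 * t1) by nra. assert (0 < t0 * t2) by nra.
  field. repeat split; nra.
Qed.

(** With [D = |w - c|^2], the numerator is [4 rho^2 D], while [tau <= rho] and [rho^2 <= D] bound
    the two denominators by [2 rho^2] and [3 D]. *)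
Lemma visual_base_far c1 c2 w1 w2 rho tau hr ht ht' :
  tau <= rho -> rho^2 <= (w1 - c1)^2 + (w2 - c2)^2 ->
  / 3 <= visual (mkH3 c1 c2 rho hr) (mkH3 c1 c2 tau ht) (mkH3 w1 w2 tau ht').
Proof.
  intros htr hw. rewrite visual_mkH3. unfold sqdist3.
  set (D := (w1 - c1)^2 + (w2 - c2)^2) in *.
  replace ((c1 - w1)^2 + (c2 - w2)^2 + (tau - tau)^2) with D by (unfold D; ring).
  replace ((c1 - w1)^2 + (c2 - w2)^2 + rho^2 + tau^2) with (D + rho^2 + tau^2)
    by (unfold D; ring).
  replace ((c1 - c1)^2 + (c2 - c2)^2 + rho^2 + tau^2) with (rho^2 + tau^2) by ring.
  clearbody D. assert (tau^2 <= rho^2) by nra. assert (0 < tau^2) by nra.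
  apply Rle_div_r; [nra |]. assert (0 <= rho^2 * D) by (apply Rmult_le_pos; lra).
  apply Rle_trans with (/ 3 * ((2 * rho^2) * (3 * D))); [| lra].
  apply Rmult_le_compat_l; [lra |]. apply Rmult_le_compat; lra.
Qed.

(** The point at height [T] stands for infinity. The denominators are at most [3 rho^2] and
    [4 (rho^2 + (tau - T)^2)], the latter because [T <= 2 (T - tau)]. *)
Lemma visual_far_infty c1 c2 z1 z2 rho tau T hr ht hT :
  tau <= rho -> 2 * tau <= T -> (z1 - c1)^2 + (z2 - c2)^2 = rho^2 ->
  / 3 <= visual (mkH3 c1 c2 rho hr) (mkH3 z1 z2 tau ht) (mkH3 c1 c2 T hT).
Proof.
  intros htr htT hz. rewrite visual_mkH3. unfold sqdist3.
  replace ((c1 - z1)^2 + (c2 - z2)^2) with (rho^2) by (rewrite <- hz; ring).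
  rewrite hz.
  replace ((c1 - c1)^2 + (c2 - c2)^2 + rho^2 + T^2) with (rho^2 + T^2) by ring.
  assert (tau^2 <= rho^2) by nra. assert (0 < tau^2) by nra.
  assert (T^2 <= 4 * (tau - T)^2) by nra. assert (0 < T^2) by nra.
  apply Rle_div_r; [nra |].
  apply Rle_trans with (/ 3 * ((3 * rho^2) * (4 * (rho^2 + (tau - T)^2)))); [| lra].
  apply Rmult_le_compat_l; [lra |]. apply Rmult_le_compat; lra.
Qed.

(** * Approach to the boundary *)

Lemma cvHbar_le u a v :
  (forall n, chordHbar a (u n) <= v n) -> is_lim_seq v 0 -> cvHbar u a.
Proof.
  intros hle hv eps heps. apply is_lim_seq_spec in hv.
  destruct (hv (mkposreal eps heps)) as [N hN]. exists N. intros n hn.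
  specialize (hN n hn). simpl in hN. rewrite Rminus_0_r in hN.
  pose proof (Rle_abs (v n)). specialize (hle n). lra.
Qed.

Lemma chord_vertical_le x y tau ht :
  chordHbar (inr (Some (x, y))) (inl (mkH3 x y tau ht)) <= 2 * tau.
Proof.
  apply Rsqr_incr_0_var; [| lra]. rewrite !Rsqr_pow2.
  unfold chordHbar, embHbar, embS, H3x, H3y, H3t, mkH3; cbn [proj1_sig fst snd].
  rewrite stereo_chord. unfold sqdist3.
  pose proof (sum3_sqr_ge0 x y 0). pose proof (sum3_sqr_ge0 x y tau).
  apply Rle_div_l; [nra |].
  replace (4 * ((x - x)^2 + (y - y)^2 + (0 - tau)^2)) with ((2 * tau)^2 * 1) by ring.
  apply Rmult_le_compat_l; [nra |]. nra.
Qed.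

(** Height [/ tau] approximates infinity at the rate at which height [tau] approximates a finite
    boundary point, so a single parameter drives both limits. *)
Lemma chord_infty_le x y tau (ht : 0 < tau) ht' :
  chordHbar (inr None) (inl (mkH3 x y (/ tau) ht')) <= 2 * tau.
Proof.
  apply Rsqr_incr_0_var; [| lra]. rewrite !Rsqr_pow2. rewrite chordHbar_sym.
  unfold chordHbar, embHbar, embS, H3x, H3y, H3t, mkH3; cbn [proj1_sig fst snd].
  rewrite stereo_chord_infty.
  pose proof (sum3_sqr_ge0 x y (/ tau)).
  apply Rle_div_l; [nra |].
  replace ((2 * tau)^2 * (x^2 + y^2 + (/ tau)^2 + 1))
    with (4 + (2 * tau)^2 * (x^2 + y^2 + 1)) by (field; lra).
  nra.
Qed.

Lemma chord_finite u v :
  chordHbar (inr (Some u)) (inr (Some v)) =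
  2 * dist2 u v / (sqrt (fst u^2 + snd u^2 + 1) * sqrt (fst v^2 + snd v^2 + 1)).
Proof.
  destruct u as [u1 u2], v as [v1 v2]. cbn [fst snd].
  assert (hu : 0 < u1^2 + u2^2 + 1) by nra. assert (hv : 0 < v1^2 + v2^2 + 1) by nra.
  pose proof (sqrt_lt_R0 _ hu). pose proof (sqrt_lt_R0 _ hv).
  apply Rsqr_inj; [apply chordHbar_ge0 | |].
  { apply Rdiv_le_0_compat; [| nra]. unfold dist2.
    pose proof (sqrt_pos ((fst (u1, u2) - fst (v1, v2))^2 + (snd (u1, u2) - snd (v1, v2))^2)).
    lra. }
  rewrite Rsqr_div', !Rsqr_mult. unfold dist2; cbn [fst snd].
  rewrite !Rsqr_sqrt; try lra; [| pose proof (sum3_sqr_ge0 (u1 - v1) (u2 - v2) 0); lra].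
  rewrite Rsqr_pow2. unfold chordHbar, embHbar, embS. rewrite stereo_chord.
  unfold sqdist3, Rsqr. field. split; lra.
Qed.

Lemma chord_finite_infty u :
  chordHbar (inr (Some u)) (inr None) = 2 / sqrt (fst u^2 + snd u^2 + 1).
Proof.
  destruct u as [u1 u2]. cbn [fst snd].
  assert (hu : 0 < u1^2 + u2^2 + 1) by nra. pose proof (sqrt_lt_R0 _ hu).
  apply Rsqr_inj; [apply chordHbar_ge0 | apply Rdiv_le_0_compat; lra |].
  rewrite Rsqr_div', Rsqr_sqrt by lra.
  rewrite Rsqr_pow2. unfold chordHbar, embHbar, embS. rewrite stereo_chord_infty.
  unfold Rsqr. field. lra.
Qed.

(** * Quasisymmetry of the boundary map *)

(** By injectivity only infinity goes to infinity, so the default value in [hC] is never taken. *)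
Lemma hC_spec f z : bijective f -> f None = None -> f (Some z) = Some (hC f z).
Proof.
  intros [hinj _] h. unfold hC. destruct (f (Some z)) eqn:e; [reflexivity |].
  rewrite <- h in e. apply hinj in e. discriminate.
Qed.

(** Membership in [G2] is expressed by an intertwining relation, so the conjugate must first exist
    as a function; choice provides the inverse of [F] for it. *)
Lemma conjugate_in_lattice (F : H3 -> H3) (G1 G2 : (H3 -> H3) -> Prop) g1 :
  bijective F ->
  (forall g, G2 g <-> exists g1, G1 g1 /\ forall p, g (F p) = F (g1 p)) ->
  G1 g1 -> exists g, G2 g /\ forall p, g (F p) = F (g1 p).
Proof.
  intros [hinj hsurj] hG h1.
  set (Finv q := proj1_sig (constructive_indefinite_description _ (hsurj q))).
  assert (hF : forall q, F (Finv q) = q).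
  { intros q. apply (proj2_sig (constructive_indefinite_description _ (hsurj q))). }
  assert (e : forall p, F (g1 (Finv (F p))) = F (g1 p)).
  { intros p. do 2 f_equal. apply hinj, hF. }
  exists (fun q => F (g1 (Finv q))). split; [| exact e].
  apply hG. exists g1. split; assumption.
Qed.

(* Move the hyperbolic point from which [z], [c], [oo] look well separated into a fixed compact
   set by an element of the first lattice. Its conjugate by [F] preserves cross ratios. *)
Lemma interior_cross_ratio_bound F f :
  equivariant_pair F f -> exists e, 0 < e /\
  forall c1 c2 z1 z2 w1 w2 rho tau (hr : 0 < rho) (ht : 0 < tau) (hT : 0 < / tau),
    tau <= rho -> tau <= 1 / 2 ->
    (z1 - c1)^2 + (z2 - c2)^2 = rho^2 -> rho^2 <= (w1 - c1)^2 + (w2 - c2)^2 ->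
    let p := F (mkH3 z1 z2 tau ht) in let q := F (mkH3 c1 c2 tau ht) in
    let r := F (mkH3 w1 w2 tau ht) in let s := F (mkH3 c1 c2 (/ tau) hT) in
    e * (chordHbar (inl p) (inl q) * chordHbar (inl r) (inl s)) <=
    chordHbar (inl q) (inl r) * chordHbar (inl p) (inl s).
Proof.
  intros ((hF & _) & ((hfinj & _) & _) & hcont & G1 & G2 & h1 & h2 & hG & _).
  destruct h1 as ((hiso1 & _ & _ & hinv) & _ & _ & (K & hK & hcov)).
  destruct h2 as ((hiso2 & _) & _).
  destruct (compact_hcosh_bounded K hK) as (M & hM & hKM).
  (* A visual distance of at least [1 / 3] and the factor [(2 * M)^2] give a squared chord of at
     least [1 / (12 M^2)], which exceeds [(1 / (4 * M))^2]. *)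
  destruct (uniformly_injective_Hbar (union_map F f) hcont) with (d := / (4 * M))
    as (e & he & hinj).
  { intros [a | a] [b | b] h; try discriminate; injection h as h.
    - f_equal. now apply (proj1 hF).
    - f_equal. now apply hfinj. }
  { apply Rinv_0_lt_compat; lra. }
  (* After applying [g2], two chords are at least [e], and the two opposite ones are at most 2, the
     diameter of the sphere. *)
  exists (e^2 / 4). split; [nra |].
  intros c1 c2 z1 z2 w1 w2 rho tau hr ht hT hle hhalf hz hw p q r s.
  set (x := mkH3 c1 c2 rho hr).
  destruct (hcov x) as (g & k & hg & hk & hgk).
  destruct (hinv g hg) as (g1 & hg1 & hcancel & _).
  assert (hx : hcosh H3o (g1 x) <= M) by (rewrite <- hgk, hcancel; auto).
  destruct (conjugate_in_lattice F G1 G2 g1 hF hG hg1) as (g2 & hg2 & hconj).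
  assert (far : forall a b, / 3 <= visual x a b ->
    e <= chordHbar (inl (F (g1 a))) (inl (F (g1 b)))).
  { intros a b hab. apply (hinj (inl (g1 a)) (inl (g1 b))).
    pose proof (visual_le_chord2 g1 x a b M (hiso1 _ hg1) hM hx) as hv.
    apply Rsqr_incr_0_var; [| apply chordHbar_ge0]. rewrite !Rsqr_pow2.
    fold (chord2 (inl (g1 a)) (inl (g1 b))).
    apply Rmult_le_reg_l with ((2 * M)^2); [nra |].
    replace ((2 * M)^2 * (/ (4 * M))^2) with (1 / 4) by (field; lra). lra. }
  assert (hqr : e <= chordHbar (inl (g2 q)) (inl (g2 r))).
  { unfold q, r. rewrite !hconj. apply far. apply visual_base_far; assumption. }
  assert (hps : e <= chordHbar (inl (g2 p)) (inl (g2 s))).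
  { unfold p, s. rewrite !hconj. apply far. apply visual_far_infty; auto.
    (* Here [2 * tau <= / tau] because [tau <= 1 / 2]. *)
    apply Rmult_le_reg_r with tau; [lra |]. rewrite Rinv_l by lra. nra. }
  pose proof (chordal_cross_ratio_isometry g2 p q r s (hiso2 _ hg2)) as hcr.
  pose proof (chordHbar_le2 (inl (g2 p)) (inl (g2 q))) as b1.
  pose proof (chordHbar_le2 (inl (g2 r)) (inl (g2 s))) as b2.
  pose proof (chordHbar_ge0 (inl (g2 p)) (inl (g2 q))) as n1.
  pose proof (chordHbar_ge0 (inl (g2 r)) (inl (g2 s))) as n2.
  pose proof (Rmult_le_pos _ _ (chordHbar_ge0 (inl p) (inl q)) (chordHbar_ge0 (inl r) (inl s)))
    as hX.
  pose proof (Rmult_le_pos _ _ (chordHbar_ge0 (inl q) (inl r)) (chordHbar_ge0 (inl p) (inl s)))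
    as hZ.
  set (X := chordHbar (inl p) (inl q) * chordHbar (inl r) (inl s)) in *.
  set (Z := chordHbar (inl q) (inl r) * chordHbar (inl p) (inl s)) in *.
  assert (he2 : e * e <= chordHbar (inl (g2 q)) (inl (g2 r)) * chordHbar (inl (g2 p)) (inl (g2 s)))
    by (apply Rmult_le_compat; lra).
  assert (h4 : chordHbar (inl (g2 p)) (inl (g2 q)) * chordHbar (inl (g2 r)) (inl (g2 s)) <= 2 * 2)
    by (apply Rmult_le_compat; lra).
  assert (X * (e * e) <= 4 * Z); [| lra].
  apply Rle_trans with (X * (chordHbar (inl (g2 q)) (inl (g2 r)) * chordHbar (inl (g2 p)) (inl (g2 s)))).
  - apply Rmult_le_compat_l; assumption.
  - rewrite hcr. apply Rmult_le_compat_r; lra.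
Qed.

Lemma dist2_ge0 z w : 0 <= dist2 z w.
Proof. apply sqrt_pos. Qed.

Lemma dist2_sqr z w : dist2 z w ^ 2 = (fst z - fst w)^2 + (snd z - snd w)^2.
Proof. apply pow2_sqrt. pose proof (sum3_sqr_ge0 (fst z - fst w) (snd z - snd w) 0). lra. Qed.

Lemma dist2_sym z w : dist2 z w = dist2 w z.
Proof. unfold dist2. f_equal. ring. Qed.

Lemma dist2_refl z : dist2 z z = 0.
Proof.
  unfold dist2. replace ((fst z - fst z)^2 + (snd z - snd z)^2) with 0 by ring. apply sqrt_0.
Qed.

Lemma dist2_eq0 z w : dist2 z w = 0 -> z = w.
Proof.
  intros h. pose proof (dist2_sqr z w) as e. rewrite h in e.
  destruct z as [z1 z2], w as [w1 w2]; cbn [fst snd] in e.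
  pose proof (pow2_ge_0 (z1 - w1)). pose proof (pow2_ge_0 (z2 - w2)). f_equal; nra.
Qed.

(** The interior cross ratio bound is applied at heights tending to 0 and passes to the limit by
    continuity of [F] with [f]. With one of the four points at infinity, the cross ratio becomes a
    ratio of Euclidean distances. *)
Lemma equivariant_pair_quasisymmetric F f :
  equivariant_pair F f -> f None = None ->
  exists K, 0 < K /\ forall c z w, dist2 z c <= dist2 w c ->
    dist2 (hC f z) (hC f c) <= K * dist2 (hC f w) (hC f c).
Proof.
  intros hpair hinf. destruct (interior_cross_ratio_bound F f hpair) as (e & he & hcr).
  destruct hpair as (_ & (hbij & _) & hcont & _).
  exists (/ e). split; [now apply Rinv_0_lt_compat |].
  intros c z w hzw.
  destruct (Rle_lt_or_eq_dec _ _ (dist2_ge0 z c)) as [hr | h0].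
  2: { apply eq_sym, dist2_eq0 in h0. subst z. rewrite dist2_refl.
       apply Rmult_le_pos; [left; now apply Rinv_0_lt_compat | apply dist2_ge0]. }
  set (rho := dist2 z c) in *.
  assert (hz : (fst z - fst c)^2 + (snd z - snd c)^2 = rho^2) by (symmetry; apply dist2_sqr).
  assert (hw : rho^2 <= (fst w - fst c)^2 + (snd w - snd c)^2).
  { rewrite <- dist2_sqr. apply pow_incr. lra. }
  clearbody rho. clear hzw.
  (* This secures both height conditions [tau <= rho] and [tau <= 1 / 2]. *)
  set (m := Rmin rho (1 / 2)).
  assert (hm : 0 < m) by (apply Rmin_pos; lra).
  set (tau n := m * / (INR n + 1)).
  assert (ht : forall n, 0 < tau n).
  { intros n. apply Rmult_lt_0_compat; [exact hm | apply RinvN_pos]. }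
  assert (hT : forall n, 0 < / tau n) by (intros n; apply Rinv_0_lt_compat, ht).
  assert (htm : forall n, tau n <= m).
  { intros n. unfold tau. rewrite <- (Rmult_1_r m) at 2. apply Rmult_le_compat_l; [lra |].
    rewrite <- Rinv_1. apply Rinv_le_contravar; [lra |]. pose proof (pos_INR n); lra. }
  assert (hlim : is_lim_seq (fun n => 2 * tau n) 0).
  { replace 0 with (2 * (m * 0)) by ring.
    apply is_lim_seq_mult'; [apply is_lim_seq_const |].
    apply is_lim_seq_mult'; [apply is_lim_seq_const |].
    apply is_lim_seq_Reals, @RinvN_cv. }
  assert (hvert : forall u, cvHbar (fun n => inl (F (mkH3 (fst u) (snd u) (tau n) (ht n))))
                              (inr (Some (hC f u)))).
  { intros u. rewrite <- hC_spec by assumption.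
    apply (cvHbar_continuous (union_map F f)
      (fun n => inl (mkH3 (fst u) (snd u) (tau n) (ht n))) (inr (Some u)) hcont).
    apply cvHbar_le with (2 := hlim). intros n. destruct u. apply chord_vertical_le. }
  assert (hs : cvHbar (fun n => inl (F (mkH3 (fst c) (snd c) (/ tau n) (hT n)))) (inr None)).
  { rewrite <- hinf at 1.
    apply (cvHbar_continuous (union_map F f)
      (fun n => inl (mkH3 (fst c) (snd c) (/ tau n) (hT n))) (inr None) hcont).
    apply cvHbar_le with (2 := hlim). intros n. apply chord_infty_le, ht. }
  assert (hle : e * (chordHbar (inr (Some (hC f z))) (inr (Some (hC f c)))
                     * chordHbar (inr (Some (hC f w))) (inr None)) <=
    chordHbar (inr (Some (hC f c))) (inr (Some (hC f w)))
                     * chordHbar (inr (Some (hC f z))) (inr None)).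
  { eapply (is_lim_seq_le _ _ (Finite _) (Finite _)).
    2: { apply is_lim_seq_mult'; [apply is_lim_seq_const |].
         apply is_lim_seq_mult'; apply is_lim_seq_chord.
         - apply (hvert z).
         - apply (hvert c).
         - apply (hvert w).
         - apply hs. }
    2: { apply is_lim_seq_mult'; apply is_lim_seq_chord.
         - apply (hvert c).
         - apply (hvert w).
         - apply (hvert z).
         - apply hs. }
    intros n. specialize (htm n). pose proof (Rmin_l rho (1 / 2)). pose proof (Rmin_r rho (1 / 2)).
    apply (hcr (fst c) (snd c) (fst z) (snd z) (fst w) (snd w) rho); auto; unfold m in htm; lra. }
  rewrite !chord_finite, !chord_finite_infty in hle.
  rewrite (dist2_sym (hC f c) (hC f w)) in hle.
  assert (hpos : forall u : pt2, 0 < sqrt (fst u^2 + snd u^2 + 1))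
    by (intros u; apply sqrt_lt_R0; nra).
  pose proof (hpos (hC f z)) as pz. pose proof (hpos (hC f c)) as pc.
  pose proof (hpos (hC f w)) as pw.
  set (Nz := sqrt (fst (hC f z)^2 + snd (hC f z)^2 + 1)) in *.
  set (Nc := sqrt (fst (hC f c)^2 + snd (hC f c)^2 + 1)) in *.
  set (Nw := sqrt (fst (hC f w)^2 + snd (hC f w)^2 + 1)) in *.
  set (dz := dist2 (hC f z) (hC f c)) in *. set (dw := dist2 (hC f w) (hC f c)) in *.
  clearbody Nz Nc Nw dz dw.
  (* Both sides carry the same conformal factors, one for each finite point; clearing them leaves
     Euclidean distances. *)
  apply Rmult_le_compat_r with (r := Nz * Nc * Nw / 4) in hle.
  2: { apply Rdiv_le_0_compat; [| lra]. repeat apply Rmult_le_pos; lra. }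
  replace (e * (2 * dz / (Nz * Nc) * (2 / Nw)) * (Nz * Nc * Nw / 4)) with (e * dz) in hle
    by (field; lra).
  replace (2 * dw / (Nc * Nw) * (2 / Nz) * (Nz * Nc * Nw / 4)) with dw in hle by (field; lra).
  apply Rmult_le_reg_l with e; [exact he |].
  replace (e * (/ e * dw)) with dw by (field; lra). exact hle.
Qed.

(** * Families of intervals and their subdivision *)

(** Translates the index form used by [nonoverlapping] and [disks_disjoint] into an inductive
    predicate suited to concatenation and [map]. *)
Lemma ForallOrdPairs_nth {A : Type} (R : A -> A -> Prop) (d : A) l :
  ForallOrdPairs R l <->
  (forall i j, (i < j < length l)%nat -> R (nth i l d) (nth j l d)).
Proof.
  induction l as [| x l IH]; split.
  - intros _ i j h. simpl in h. lia.
  - constructor.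
  - intros h i j hij. inversion h as [| ? ? hx hl]; subst.
    destruct j as [| j]; [lia |]. cbn [length] in hij. destruct i as [| i]; cbn [nth].
    + rewrite Forall_forall in hx. apply hx, nth_In. lia.
    + apply IH; [exact hl | lia].
  - intros h. constructor.
    + apply Forall_forall. intros z hz. destruct (In_nth l z d hz) as (j & hj & <-).
      apply (h 0%nat (S j)). cbn [length]. lia.
    + apply IH. intros i j hij. apply (h (S i) (S j)). cbn [length]. lia.
Qed.

Lemma ForallOrdPairs_app {A : Type} (R : A -> A -> Prop) l1 l2 :
  ForallOrdPairs R l1 -> ForallOrdPairs R l2 ->
  (forall x y, In x l1 -> In y l2 -> R x y) -> ForallOrdPairs R (l1 ++ l2).
Proof.
  intros h1 h2 h12. induction h1 as [| x l1 hx h1 IH]; [exact h2 |].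
  cbn [app]. constructor.
  - apply Forall_app. split; [exact hx |]. apply Forall_forall. intros z hz.
    apply h12; [now left | exact hz].
  - apply IH. intros u v hu hv. apply h12; [now right | exact hv].
Qed.

Lemma ForallOrdPairs_map {A B : Type} (R : A -> A -> Prop) (S : B -> B -> Prop)
    (g : A -> B) (l : list A) :
  (forall x y, In x l -> In y l -> R x y -> S (g x) (g y)) ->
  ForallOrdPairs R l -> ForallOrdPairs S (map g l).
Proof.
  intros hg h. induction h as [| x l hx h IH]; cbn [map]; constructor.
  - apply Forall_map, Forall_forall. intros z hz. rewrite Forall_forall in hx.
    apply hg; [now left | now right | now apply hx].
  - apply IH. intros u v hu hv. apply hg; now right.
Qed.

Definition nonoverlap (p q : R * R) : Prop := snd p <= fst q \/ snd q <= fst p.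

(** [variation] and [total_length] are convertible to the two sums in [abs_cont_01]. *)
Definition variation (u : R -> R) (l : list (R * R)) : R :=
  fold_right (fun ab s => Rabs (u (snd ab) - u (fst ab)) + s) 0 l.

Definition total_length (l : list (R * R)) : R :=
  fold_right (fun ab s => (snd ab - fst ab) + s) 0 l.

Lemma variation_app u l1 l2 : variation u (l1 ++ l2) = variation u l1 + variation u l2.
Proof. unfold variation. induction l1 as [| p l1 IH]; simpl; [ring | rewrite IH; ring]. Qed.

Fixpoint uniform_pieces (a h : R) (n : nat) : list (R * R) :=
  match n with
  | 0%nat => nil
  | S n => (a, a + h) :: uniform_pieces (a + h) h n
  end.

(** Induction on [n]; the last clause is the triangle inequality for a telescoping sum. *)
Lemma uniform_pieces_spec u a h n : 0 < h ->
  let l := uniform_pieces a h n in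
  length l = n /\ ForallOrdPairs nonoverlap l /\
  (forall p, In p l -> snd p - fst p = h /\ a <= fst p /\ snd p <= a + INR n * h) /\
  Rabs (u (a + INR n * h) - u a) <= variation u l.
Proof.
  intros hh. revert a. induction n as [| n IH]; intros a l.
  - split; [reflexivity |]. split; [constructor |]. split; [intros p [] |].
    simpl. replace (a + 0 * h) with a by ring. rewrite Rminus_diag, Rabs_R0. lra.
  - destruct (IH (a + h)) as (h1 & h2 & h3 & h4). unfold l. cbn [uniform_pieces].
    replace (a + h + INR n * h) with (a + INR (S n) * h) in h3, h4 by (rewrite S_INR; ring).
    assert (hn : 0 <= INR n * h) by (apply Rmult_le_pos; [apply pos_INR | lra]).
    split; [cbn [length]; now rewrite h1 |]. split; [| split].
    + constructor; [| exact h2]. apply Forall_forall. intros p hp. left. cbn [snd].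
      now apply h3.
    + intros p [<- | hp]; cbn [fst snd].
      * rewrite S_INR. lra.
      * destruct (h3 p hp). lra.
    + unfold variation in *. cbn [fold_right fst snd].
      set (b := a + INR (S n) * h) in *.
      replace (u b - u a) with ((u (a + h) - u a) + (u b - u (a + h))) by ring.
      eapply Rle_trans; [apply Rabs_triang |]. lra.
Qed.

(** A nondegenerate interval of length [L] is cut into [floor (L / (2 r)) + 1] equal pieces. The
    added 1 per interval accounts for the second term of the count, and the variation can only grow
    under subdivision. *)
Lemma refine_intervals u r l : 0 < r ->
  (forall p, In p l -> fst p <= snd p) -> ForallOrdPairs nonoverlap l ->
  exists l', ForallOrdPairs nonoverlap l' /\
    (forall p', In p' l' -> fst p' < snd p' <= fst p' + 2 * r /\
       exists p, In p l /\ fst p <= fst p' /\ snd p' <= snd p) /\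
    INR (length l') * (2 * r) <= total_length l + INR (length l) * (2 * r) /\
    variation u l <= variation u l'.
Proof.
  intros hr hl hno. induction hno as [| [a b] l hab hno IH].
  { exists nil. split; [constructor |]. split; [intros p [] |]. simpl. lra. }
  destruct IH as (l' & h1 & h2 & h3 & h4); [intros p hp; apply hl; now right |].
  assert (hle : a <= b) by (apply (hl (a, b)); now left).
  assert (hlen : INR (length ((a, b) :: l)) = INR (length l) + 1) by (cbn [length]; apply S_INR).
  assert (hsub : forall p', In p' l' -> exists p, In p ((a, b) :: l) /\ fst p <= fst p' /\ snd p' <= snd p).
  { intros p' hp'. destruct (h2 p' hp') as (_ & p & hp & hpp). exists p. split; [now right | exact hpp]. }
  assert (htl : total_length ((a, b) :: l) = (b - a) + total_length l) by reflexivity.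
  assert (hva : variation u ((a, b) :: l) = Rabs (u b - u a) + variation u l) by reflexivity.
  destruct (Rle_lt_or_eq_dec _ _ hle) as [hlt | <-].
  (* A degenerate interval is dropped: it has no variation, and it would give a disk of radius 0. *)
  2: { exists l'. split; [exact h1 |]. split; [| split].
       - intros p' hp'. split; [now apply h2 | now apply hsub].
       - rewrite hlen, htl. lra.
       - rewrite hva, Rminus_diag, Rabs_R0. lra. }
  destruct (nfloor_ex ((b - a) / (2 * r))) as [n [hn1 hn2]].
  { apply Rdiv_le_0_compat; lra. }
  pose proof (pos_INR n) as hn0.
  set (h := (b - a) / (INR n + 1)).
  assert (hh : 0 < h) by (apply Rdiv_lt_0_compat; lra).
  assert (hb : a + INR (S n) * h = b) by (rewrite S_INR; unfold h; field; lra).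
  assert (hh2 : h <= 2 * r).
  { unfold h. apply Rle_div_l; [lra |]. apply Rlt_div_l in hn2; lra. }
  apply Rle_div_r in hn1; [| lra].
  destruct (uniform_pieces_spec u a h (S n) hh) as (k1 & k2 & k3 & k4).
  rewrite hb in k3, k4. set (m := uniform_pieces a h (S n)) in *. clearbody m.
  exists (m ++ l'). split; [| split; [| split]].
  - apply ForallOrdPairs_app; [exact k2 | exact h1 |]. intros p q hp hq.
    destruct (h2 q hq) as (_ & q' & hq' & hq1 & hq2). destruct (k3 p hp) as (_ & hp1 & hp2).
    rewrite Forall_forall in hab. destruct (hab q' hq') as [hs | hs]; cbn [fst snd] in hs.
    + left. lra.
    + right. lra.
  - intros p' hp'. apply in_app_iff in hp'. destruct hp' as [hp' | hp'].
    + destruct (k3 p' hp') as (e1 & e2 & e3). split; [lra |]. exists (a, b). split; [now left |].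
      split; assumption.
    + split; [now apply h2 | now apply hsub].
  - rewrite length_app, plus_INR, k1, hlen, htl, S_INR. lra.
  - rewrite variation_app, hva. lra.
Qed.

(** * From disk areas to variation *)

(** Cauchy-Schwarz in the form [s <= (lam + s^2 / lam) / 2], summed over the radii [s], with [lam]
    left free to be optimised; [PI >= 1] replaces [s^2] by the area. *)
Lemma variation_le_area u (D : R * R -> pt2 * R) C lam l : 0 < lam -> 0 <= C ->
  (forall p, In p l -> Rabs (u (snd p) - u (fst p)) <= C * snd (D p)) ->
  variation u l <= C / 2 * (INR (length l) * lam + total_area (map D l) / lam).
Proof.
  intros hlam hC hl. induction l as [| p l IH].
  { simpl. unfold Rdiv. lra. }
  assert (IH' := IH (fun q hq => hl q (or_intror hq))).
  specialize (hl p (or_introl eq_refl)).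
  unfold variation, total_area in *. cbn [map fold_right length]. rewrite S_INR.
  set (V := fold_right _ 0 l) in *. set (A := fold_right _ 0 (map D l)) in *.
  set (s := snd (D p)) in *. clearbody V A s.
  assert (hs : s <= / 2 * (lam + PI * s^2 / lam)).
  { replace (/ 2 * (lam + PI * s^2 / lam)) with ((lam^2 + PI * s^2) / (2 * lam)) by (field; lra).
    apply Rle_div_r; [lra |]. pose proof PI2_3_2. pose proof (pow2_ge_0 (lam - s)).
    pose proof (pow2_ge_0 s). nra. }
  apply Rmult_le_compat_l with (r := C) in hs; [| exact hC].
  replace (C / 2 * ((INR (length l) + 1) * lam + (PI * s^2 + A) / lam))
    with (C * (/ 2 * (lam + PI * s^2 / lam)) + C / 2 * (INR (length l) * lam + A / lam))
    by (field; lra).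
  lra.
Qed.

(** Every admissible family of disks is a candidate in the supremum [alpha], so an area of
    [N * (2 * r)] or more would contradict stiffness. *)
Lemma stiff_area_bound f y : stiff f y -> exists N, forall r l,
  0 < r -> 0 <= y - r -> y + r <= 1 ->
  (forall d, In d l -> disk_in
     (fun z => exists s t, 0 <= s <= 1 /\ y - r <= t <= y + r /\ z = hC f (s, t)) d) ->
  disks_disjoint l -> total_area l < N * (2 * r).
Proof.
  intros [N hN]. exists N. intros r l hr h0 h1 hl hdis.
  apply Rnot_le_lt. intros hle. apply (hN r hr h0 h1).
  apply Rbar_le_trans with (Finite (total_area l)); [exact hle |].
  unfold A_fun, alpha. apply Lub_Rbar_correct. exists l. auto.
Qed.

Lemma fst_le_dist2 z w : Rabs (fst z - fst w) <= dist2 z w.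
Proof.
  unfold dist2. rewrite <- sqrt_Rsqr_abs. apply sqrt_le_1_alt. unfold Rsqr.
  pose proof (pow2_ge_0 (snd z - snd w)). lra.
Qed.

Lemma snd_le_dist2 z w : Rabs (snd z - snd w) <= dist2 z w.
Proof.
  unfold dist2. rewrite <- sqrt_Rsqr_abs. apply sqrt_le_1_alt. unfold Rsqr.
  pose proof (pow2_ge_0 (fst z - fst w)). lra.
Qed.

Lemma dist2_horizontal s t y : dist2 (s, y) (t, y) = Rabs (s - t).
Proof.
  unfold dist2; cbn [fst snd]. rewrite <- sqrt_Rsqr_abs. f_equal. unfold Rsqr. ring.
Qed.

(** * Absolute continuity on the horizontal segment *)

Theorem theorem3p7 :
  forall (F : H3 -> H3) (f : Sbd -> Sbd),
    equivariant_pair F f ->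
    f None = None ->
    forall y : R, 0 < y < 1 ->
    stiff f y ->
    forall a b : R,
      abs_cont_01 (fun t => a * fst (hC f (t, y)) + b * snd (hC f (t, y))).
Proof.
  intros F f hpair hinf y hy hstiff a b.
  destruct (equivariant_pair_quasisymmetric F f hpair hinf) as (K & hK & hqs).
  destruct (stiff_area_bound f y hstiff) as [N hN].
  assert (hbij : bijective f) by apply hpair. clear hpair hstiff.
  assert (hspec : forall z, f (Some z) = Some (hC f z)) by (intros z; now apply hC_spec).
  assert (hinj : forall z w, hC f z = hC f w -> z = w).
  { intros z w h. assert (e : Some z = Some w) by (apply (proj1 hbij); now rewrite !hspec, h).
    now injection e. }
  assert (hsurj : forall w, exists z, hC f z = w).
  { intros w. destruct (proj2 hbij (Some w)) as [[z |] hz]; [| congruence].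
    exists z. rewrite hspec in hz. now injection hz. }
  clear hbij hspec hinf.
  (* The empty family of disks already has area 0. *)
  assert (hNpos : 0 < N).
  { assert (hr : 0 < Rmin y (1 - y)) by (apply Rmin_pos; lra).
    pose proof (Rmin_l y (1 - y)). pose proof (Rmin_r y (1 - y)).
    assert (h : total_area nil < N * (2 * Rmin y (1 - y))).
    { apply hN; try lra; [now intros | intros i j hij; simpl in hij; lia]. }
    simpl in h. nra. }
  set (h := hC f) in *.
  set (u t := a * fst (h (t, y)) + b * snd (h (t, y))).
  set (mid (p : R * R) := ((fst p + snd p) / 2, y)).
  (* The image disk of a piece: by quasisymmetry, a disk of this radius about the image of the
     midpoint fits into the image of the disk with diameter [p]. *)
  set (D p := (h (mid p), dist2 (h (fst p, y)) (h (mid p)) / K)).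
  (* A Lipschitz constant of the projection; the 1 keeps it positive when [a = b = 0]. *)
  set (P := Rabs a + Rabs b + 1).
  assert (hP : 0 < P) by (pose proof (Rabs_pos a); pose proof (Rabs_pos b); unfold P; lra).
  assert (hu : forall s t, Rabs (u s - u t) <= P * dist2 (h (s, y)) (h (t, y))).
  { intros s t. unfold u, P.
    pose proof (fst_le_dist2 (h (s, y)) (h (t, y))) as h1.
    pose proof (snd_le_dist2 (h (s, y)) (h (t, y))) as h2.
    set (d := dist2 _ _) in *. assert (hd : 0 <= d) by apply dist2_ge0.
    replace (a * fst (h (s, y)) + b * snd (h (s, y)) - (a * fst (h (t, y)) + b * snd (h (t, y))))
      with (a * (fst (h (s, y)) - fst (h (t, y))) + b * (snd (h (s, y)) - snd (h (t, y)))) by ring.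
    eapply Rle_trans; [apply Rabs_triang |]. rewrite !Rabs_mult.
    apply Rmult_le_compat_l with (r := Rabs a) in h1; [| apply Rabs_pos].
    apply Rmult_le_compat_l with (r := Rabs b) in h2; [| apply Rabs_pos]. lra. }
  (* Passing through the midpoint, the image moves by at most [1 + K] times the distance from the
     left end's image to the midpoint's, which is [K] times the radius. *)
  set (C := P * (1 + K) * K).
  assert (hCpos : 0 < C) by (unfold C; repeat apply Rmult_lt_0_compat; lra).
  assert (hend : forall p, fst p < snd p ->
    dist2 (fst p, y) (mid p) = (snd p - fst p) / 2 /\ dist2 (snd p, y) (mid p) = (snd p - fst p) / 2).
  { intros p hp. unfold mid. rewrite !dist2_horizontal. split.
    - rewrite Rabs_left1; lra.
    - rewrite Rabs_pos_eq; lra. }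
  assert (hvar : forall p, fst p < snd p -> Rabs (u (snd p) - u (fst p)) <= C * snd (D p)).
  { intros p hp. destruct (hend p hp) as [e1 e2].
    assert (hq : dist2 (h (snd p, y)) (h (mid p)) <= K * dist2 (h (fst p, y)) (h (mid p)))
      by (apply hqs; lra).
    pose proof (hu (snd p) ((fst p + snd p) / 2)) as h1.
    pose proof (hu (fst p) ((fst p + snd p) / 2)) as h2.
    fold (mid p) in h1, h2. rewrite Rabs_minus_sym in h2.
    set (m := (fst p + snd p) / 2) in *.
    replace (u (snd p) - u (fst p)) with ((u (snd p) - u m) + (u m - u (fst p))) by ring.
    eapply Rle_trans; [apply Rabs_triang |].
    unfold D, C; cbn [snd].
    replace (P * (1 + K) * K * (dist2 (h (fst p, y)) (h (mid p)) / K))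
      with (P * (K * dist2 (h (fst p, y)) (h (mid p))) + P * dist2 (h (fst p, y)) (h (mid p)))
      by (field; lra).
    apply Rmult_le_compat_l with (r := P) in hq; lra. }
  (* Contrapositive of quasisymmetry: a point at least half a length from the midpoint has its image
     outside the image disk. *)
  assert (hdisk : forall p w, fst p < snd p -> dist2 w (fst (D p)) < snd (D p) ->
    exists z, h z = w /\ dist2 z (mid p) < (snd p - fst p) / 2).
  { intros p w hp hw. destruct (hsurj w) as [z hz]. exists z. split; [exact hz |].
    apply Rnot_le_lt. intros hle. destruct (hend p hp) as [e1 _].
    assert (hq : dist2 (h (fst p, y)) (h (mid p)) <= K * dist2 (h z) (h (mid p)))
      by (apply hqs; lra).
    unfold D in hw; cbn [fst snd] in hw. rewrite hz in hq.
    apply Rlt_div_r in hw; lra. }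
  assert (hmid : forall p z, dist2 z (mid p) < (snd p - fst p) / 2 ->
    fst p < fst z < snd p /\ Rabs (snd z - y) < (snd p - fst p) / 2).
  { intros p z hz. pose proof (fst_le_dist2 z (mid p)) as h1.
    pose proof (snd_le_dist2 z (mid p)) as h2. change (snd (mid p)) with y in h2.
    change (fst (mid p)) with ((fst p + snd p) / 2) in h1.
    split; [| lra]. apply Rabs_le_between in h1. lra. }
  intros eps heps.
  (* The final bound is [C / 2 * (del * mu + 2 * N / mu)]. This [mu] and the [del] below make each
     summand [eps / (2 * C)], for a total of [eps / 2]; neither depends on the family [l]. *)
  set (mu := 4 * C * N / eps).
  assert (hmu : 0 < mu) by (apply Rdiv_lt_0_compat; [repeat apply Rmult_lt_0_compat |]; lra).
  set (del := eps / (2 * C * mu)).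
  assert (hdel : 0 < del)
    by (apply Rdiv_lt_0_compat; [lra | apply Rmult_lt_0_compat; lra]).
  exists del. split; [exact hdel |]. intros l hl hno hlen.
  change (total_length l < del) in hlen. change (variation u l < eps).
  assert (hno' : ForallOrdPairs nonoverlap l) by (apply (ForallOrdPairs_nth _ (0, 0)); exact hno).
  pose proof (pos_INR (length l)) as hm.
  (* The strip width may depend on [l]. The last term keeps the extra pieces, one per interval, from
     adding more than [del] to the count times [2 r]. *)
  set (r := Rmin (Rmin y (1 - y)) (del / (2 * (INR (length l) + 1)))).
  assert (hr : 0 < r).
  { repeat apply Rmin_pos; try lra. apply Rdiv_lt_0_compat; lra. }
  assert (hry : r <= y /\ r <= 1 - y /\ INR (length l) * (2 * r) <= del).
  { pose proof (Rmin_l (Rmin y (1 - y)) (del / (2 * (INR (length l) + 1)))) as i1.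
    pose proof (Rmin_r (Rmin y (1 - y)) (del / (2 * (INR (length l) + 1)))) as i2.
    fold r in i1, i2. pose proof (Rmin_l y (1 - y)). pose proof (Rmin_r y (1 - y)).
    apply Rle_div_r in i2; [| lra]. repeat split; lra. }
  destruct (refine_intervals u r l hr) as (l' & k1 & k2 & k3 & k4); [| exact hno' |].
  { intros p hp. apply (hl p hp). }
  assert (harea : total_area (map D l') < N * (2 * r)).
  { apply hN; try lra.
    - intros d hd. apply in_map_iff in hd. destruct hd as (p & <- & hp).
      destruct (k2 p hp) as ((q1 & q2) & p0 & hp0 & q3 & q4). destruct (hl p0 hp0) as [q5 q6].
      split.
      (* The radius is positive because [h] is injective and the piece is nondegenerate. *)
      + unfold D; cbn [snd]. apply Rdiv_lt_0_compat; [| exact hK].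
        destruct (Rle_lt_or_eq_dec _ _ (dist2_ge0 (h (fst p, y)) (h (mid p)))) as [hd | hd];
          [exact hd |].
        apply eq_sym, dist2_eq0, hinj in hd. unfold mid in hd. injection hd. lra.
      + intros w hw. destruct (hdisk p w q1 hw) as (z & <- & hz).
        (* Pieces have length at most [2 * r], so the disk on a piece stays within the strip of
           half-width [r] about height [y]. *)
        destruct (hmid p z hz) as (z1 & z2). apply Rlt_le, Rabs_le_between in z2.
        exists (fst z), (snd z). repeat split; try lra. now destruct z.
    - refine (proj1 (ForallOrdPairs_nth (fun d e : pt2 * R => forall w,
        ~ (dist2 w (fst d) < snd d /\ dist2 w (fst e) < snd e)) ((0, 0), 0) _) _).
      apply ForallOrdPairs_map with (R := nonoverlap); [| exact k1].
      intros p q hp hq hpq w [hw1 hw2].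
      destruct (k2 p hp) as ((p1 & _) & _). destruct (k2 q hq) as ((q1 & _) & _).
      (* The two preimages of a common point agree, and its first coordinate would lie inside two
         nonoverlapping intervals. *)
      destruct (hdisk p w p1 hw1) as (z & e & hz). destruct (hdisk q w q1 hw2) as (z' & e' & hz').
      rewrite <- e' in e. apply hinj in e. subst z'.
      apply hmid in hz, hz'. destruct hpq; lra. }
  (* Scaling [lam] with [r] balances a count of order [del / r] against an area of order [N * r], so
     [r] cancels. *)
  assert (hfin := variation_le_area u D C (r * mu) l').
  assert (hrm : 0 < r * mu) by (apply Rmult_lt_0_compat; lra).
  specialize (hfin hrm (Rlt_le _ _ hCpos) (fun p hp => hvar p (proj1 (proj1 (k2 p hp))))).
  assert (hcount : INR (length l') * (r * mu) <= del * mu).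
  { rewrite <- Rmult_assoc. apply Rmult_le_compat_r; lra. }
  assert (hquot : total_area (map D l') / (r * mu) <= 2 * N / mu).
  { apply Rle_div_l; [lra |].
    replace (2 * N / mu * (r * mu)) with (N * (2 * r)) by (field; lra). lra. }
  apply Rle_lt_trans with (1 := k4). apply Rle_lt_trans with (1 := hfin).
  apply Rle_lt_trans with (C / 2 * (del * mu + 2 * N / mu)).
  { apply Rmult_le_compat_l; lra. }
  replace (C / 2 * (del * mu + 2 * N / mu)) with (eps / 2); [lra |].
  unfold del. replace (2 * N / mu) with (eps / (2 * C)) by (unfold mu; field; lra).
  field. lra.
Qed.
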